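(* Let $d\ge 2$, $n\ge 0$, let $x_1,\dots,x_m\in\mathbb{S}^d$ and let $w_1,\dots,w_m>0$. Assume there is $\eta\in[0,1)$ such that the Marcinkiewicz--Zygmund property $$\left|\sum_{j=1}^m w_j\chi(x_j)^2-\int_{\mathbb{S}^d}\chi^2\,\mathrm{d}\omega_d\right|\le \eta\int_{\mathbb{S}^d}\chi^2\,\mathrm{d}\omega_d\qquad\text{for all }\chi\in\mathbb{P}_n(\mathbb{S}^d)$$ holds (no polynomial exactness of the quadrature rule is assumed). Let $f\in\mathcal{C}(\mathbb{S}^d)$ and let $\mathcal{U}_nf$ be its unfettered hyperinterpolant of degree $n$ built from these points and weights. Then $$\|\mathcal{U}_nf\|_{L^2}\le\sqrt{1+\eta}\left(\sum_{j=1}^m w_j\right)^{1/2}\|f\|_\infty$$ and $$\|\mathcal{U}_nf-f\|_{L^2}\le\left(\sqrt{1+\eta}\left(\sum_{j=1}^m w_j\right)^{1/2}+|\mathbb{S}^d|^{1/2}\right)E_n(f)+\sqrt{\eta^2+4\eta}\,\|\chi^*\|_{L^2},$$ where $E_n(f)=\inf_{\chi\in\mathbb{P}_n(\mathbb{S}^d)}\|f-\chi\|_\infty$ and $\chi^*\in\mathbb{P}_n(\mathbb{S}^d)$ is a best uniform approximation of $f$, i.e. $\|f-\chi^*\|_\infty=E_n(f)$.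
   Context: $\mathbb{S}^d$ is the unit sphere in $\mathbb{R}^{d+1}$, $\omega_d$ its (unnormalized) surface measure, $|\mathbb{S}^d|=\int_{\mathbb{S}^d}\mathrm{d}\omega_d$. $\mathcal{C}(\mathbb{S}^d)$ is the space of real-valued continuous functions with uniform norm $\|\cdot\|_\infty$; $\|\cdot\|_{L^2}$ is the norm of real $L^2(\mathbb{S}^d,\omega_d)$. $\mathbb{P}_n(\mathbb{S}^d)$ is the space of restrictions to $\mathbb{S}^d$ of real polynomials on $\mathbb{R}^{d+1}$ of degree at most $n$. For each $\ell\ge 0$, $\{Y_{\ell,k}:k=1,\dots,Z(d,\ell)\}$ is an $L^2$-orthonormal basis of the real spherical harmonics of exact degree $\ell$, where $Z(d,\ell)$ is the dimension of that space. Given points $x_j$ and weights $w_j>0$, put $\langle f,g\rangle_m=\sum_{j=1}^m w_jf(x_j)g(x_j)$. The unfettered hyperinterpolant of $f\in\mathcal{C}(\mathbb{S}^d)$ is $\mathcal{U}_nf=\sum_{\ell=0}^n\sum_{k=1}^{Z(d,\ell)}\langle f,Y_{\ell,k}\rangle_mY_{\ell,k}\in\mathbb{P}_n(\mathbb{S}^d)$. *)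

(* Defs.v *)
From HB Require Import structures.
From mathcomp Require Import all_boot all_order all_algebra.
(* [mpoly] has to come before the analysis library: in the opposite order the
   notations of the two clash. *)
From mathcomp Require Import mpoly.
From mathcomp Require Import all_classical all_reals all_analysis.
From mathcomp Require Import measurable_realfun.

Set Implicit Arguments.
Unset Strict Implicit.
Unset Printing Implicit Defensive.

Import Order.TTheory GRing.Theory Num.Theory.
Import numFieldNormedType.Exports.

Local Open Scope classical_set_scope.
Local Open Scope ring_scope.

(* The product sigma-algebra on row vectors, as in the library's instance for
   tuples; over the reals these are the Borel sets of R^n. *)
Definition rV_display : measure_display -> measure_display.
Proof. exact. Qed.

Section measurable_rV.
Context d {T : measurableType d} (n : nat).

Definition rV_coord (i : 'I_n) (x : 'rV[T]_n) : T := x ord0 i.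

Let rV_set0 : g_sigma_preimage rV_coord set0.
Proof. exact: sigma_algebra0. Qed.

Let rV_setC A : g_sigma_preimage rV_coord A -> g_sigma_preimage rV_coord (~` A).
Proof. exact: sigma_algebraC. Qed.

Let rV_bigcup (F : _^nat) : (forall i, g_sigma_preimage rV_coord (F i)) ->
  g_sigma_preimage rV_coord (\bigcup_i (F i)).
Proof. exact: sigma_algebra_bigcup. Qed.

HB.instance Definition _ := @isMeasurable.Build (rV_display d)
  'rV[T]_n (g_sigma_preimage rV_coord) rV_set0 rV_setC rV_bigcup.

End measurable_rV.

Lemma measurable_rV_coord d (T : measurableType d) n (i : 'I_n) :
  measurable_fun [set: 'rV[T]_n] (fun x : 'rV[T]_n => x ord0 i).
Proof.
move=> _ Y mY; rewrite setTI; apply: sub_sigma_algebra => /=.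
rewrite -bigcup_seq/=; exists i => /=; first by rewrite mem_index_enum.
by exists Y => //; rewrite setTI.
Qed.

Lemma measurable_fun_rV d1 d2 (T1 : measurableType d1) (T2 : measurableType d2)
    n (f : T1 -> 'rV[T2]_n) :
  (forall i, measurable_fun [set: T1] (fun t => f t ord0 i)) ->
  measurable_fun [set: T1] f.
Proof.
move=> mf.
suff : preimage_set_system [set: T1] f (@measurable _ 'rV[T2]_n) `<=` measurable.
  by move=> sub _ A mA; apply: sub; exists A.
rewrite -[X in X `<=` _](g_sigma_preimage_comp (@rV_coord _ T2 n) f).
apply: smallest_sub; first exact: sigma_algebra_measurable.
rewrite -bigcup_seq/=; apply: bigcup_sub => i _ A [B mB <-].
exact: mf.
Qed.

Section lebesgue_rV.
Context {R : realType}.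

Definition rV_cons n (p : R * 'rV[R]_n) : 'rV[R]_n.+1 :=
  row_mx (const_mx p.1 : 'rV[R]_1) p.2.

Lemma rV_cons0 n p : @rV_cons n p ord0 ord0 = p.1.
Proof.
by rewrite /rV_cons !mxE; case: splitP => [j _|j //]; rewrite mxE.
Qed.

Lemma rV_consS n p (i : 'I_n) : rV_cons p ord0 (lift ord0 i) = p.2 ord0 i.
Proof.
rewrite /rV_cons !mxE; case: splitP => [j|j [ij]]; first by rewrite (ord1 j).
by congr (p.2 _ _); apply: val_inj.
Qed.

Lemma measurable_rV_cons n :
  measurable_fun [set: measurableTypeR R * 'rV[R]_n] (@rV_cons n).
Proof.
apply: measurable_fun_rV => i; have [->|[j ->]] : i = ord0 \/ exists j, i = lift ord0 j.
- by case: (unliftP ord0 i) => [j ->|->]; [right; exists j|left].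
- rewrite (_ : (fun _ => _) = fst); first exact: measurable_fst.
  by apply/funext => p; exact: rV_cons0.
- rewrite (_ : (fun _ => _) = (fun x : 'rV[R]_n => x ord0 j) \o snd).
    by apply: measurableT_comp; [exact: measurable_rV_coord|exact: measurable_snd].
  by apply/funext => p; exact: rV_consS.
Qed.

Let rV_uncons n (x : 'rV[R]_n.+1) : R * 'rV[R]_n :=
  (x ord0 ord0, \row_i x ord0 (lift ord0 i)).

Let rV_uncons_cons n p : @rV_uncons n (rV_cons p) = p.
Proof.
case: p => a v; rewrite /rV_uncons rV_cons0; congr pair.
by apply/rowP => i; rewrite mxE rV_consS.
Qed.

Let measurable_rV_uncons n :
  measurable_fun [set: 'rV[R]_n.+1]
    (@rV_uncons n : _ -> measurableTypeR R * 'rV[R]_n).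
Proof.
apply: measurable_fun_pair; first exact: measurable_rV_coord.
apply: measurable_fun_rV => i.
rewrite (_ : (fun _ => _) = (fun x : 'rV[R]_n.+1 => x ord0 (lift ord0 i))).
  exact: measurable_rV_coord.
by apply/funext => x; rewrite mxE.
Qed.

Section step.
Variables (n : nat) (mu : {sigma_finite_measure set 'rV[R]_n -> \bar R}).

Definition lebesgue_rVS : set 'rV[R]_n.+1 -> \bar R :=
  pushforward (lebesgue_measure \x mu)%E (@rV_cons n).

HB.instance Definition _ := Measure.copy lebesgue_rVS
  (measure_function_pushforward__canonical__measure_function_Measure
     (lebesgue_measure \x mu)%E (@measurable_rV_cons n)).

Let lebesgue_rVS_sigma_finite : sigma_finite setT lebesgue_rVS.
Proof.
have /sigma_finiteP[F [FT ndF mF]] := sigma_finiteT (@lebesgue_measure R).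
have /sigma_finiteP[G [GT ndG mG]] := sigma_finiteT mu.
exists (fun i => @rV_uncons n @^-1` (F i `*` G i)).
  apply/esym; rewrite -subTset => x _.
  have [i _ Fi] : (\bigcup_i F i) (x ord0 ord0) by rewrite -FT.
  have [j _ Gj] : (\bigcup_j G j) (rV_uncons x).2 by rewrite -GT.
  exists (maxn i j) => //; split.
  - by move: Fi; exact/subsetPset/ndF/leq_maxl.
  - by move: Gj; exact/subsetPset/ndG/leq_maxr.
move=> i; have [mFi Fioo] := mF i; have [mGi Gioo] := mG i; split.
  rewrite -[X in measurable X]setTI; apply: measurable_rV_uncons => //.
  exact: measurableX.
rewrite /lebesgue_rVS /pushforward -comp_preimage.
rewrite (_ : _ \o _ = id); last by apply/funext => p; exact: rV_uncons_cons.
by rewrite preimage_id product_measure1E// lte_mul_pinfty// ge0_fin_numE.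
Qed.

HB.instance Definition _ := Measure_isSigmaFinite.Build _ _ _ lebesgue_rVS
  lebesgue_rVS_sigma_finite.

End step.

Fixpoint lebesgue_rV n : {sigma_finite_measure set 'rV[R]_n -> \bar R} :=
  match n with
  | 0 => dirac (0 : 'rV[R]_0)
  | n.+1 => lebesgue_rVS (lebesgue_rV n)
  end.

End lebesgue_rV.

Section sphere.
Context {R : realType}.

Definition enorm n (x : 'rV[R]_n) : R := Num.sqrt (\sum_i x ord0 i ^+ 2).

Definition sphere d : set 'rV[R]_d.+1 := [set x | enorm x = 1].

Definition radial d (x : 'rV[R]_d.+1) : 'rV[R]_d.+1 := (enorm x)^-1 *: x.

Definition punctured_ball d : set 'rV[R]_d.+1 := [set x | 0 < enorm x <= 1].

Lemma measurable_enorm n : measurable_fun [set: 'rV[R]_n] (@enorm n).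
Proof.
rewrite (_ : @enorm n = fun x => (\sum_i x ord0 i ^+ 2) `^ 2^-1).
  apply: (@measurableT_comp _ _ _ _ _ _ (@powR R ^~ 2^-1)) => //.
  apply: measurable_sum => i; apply: measurable_funX; exact: measurable_rV_coord.
by apply/funext => x; rewrite powR12_sqrt// sumr_ge0// => i _; exact: sqr_ge0.
Qed.

Lemma measurable_radial d : measurable_fun [set: 'rV[R]_d.+1] (@radial d).
Proof.
apply: measurable_fun_rV => i.
rewrite (_ : (fun _ => _) = (fun x : 'rV[R]_d.+1 => enorm x `^ (-1) * x ord0 i)).
  apply: measurable_funM; last exact: measurable_rV_coord.
  apply: (@measurableT_comp _ _ _ _ _ _ (@powR R ^~ (-1))) => //.
  exact: measurable_enorm.
by apply/funext => x; rewrite mxE powR_inv1// sqrtr_ge0.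
Qed.

Lemma measurable_punctured_ball d : measurable (@punctured_ball d).
Proof.
rewrite (_ : @punctured_ball d = @enorm d.+1 @^-1` `]0, 1]).
  by rewrite -[X in measurable X]setTI; exact: measurable_enorm.
by apply/seteqP; split => x /=; rewrite in_itv.
Qed.

(* Surface measure as the cone measure: [A] has (d + 1) times the Lebesgue
   measure of the cone {t a | a in A, 0 < t <= 1}. It is a measure on the
   ambient space that does not charge the complement of the sphere. *)
Definition sphere_measure d (A : set 'rV[R]_d.+1) : \bar R :=
  ((d.+1%:R)%:E *
   lebesgue_rV d.+1 (@radial d @^-1` A `&` @punctured_ball d))%E.

HB.instance Definition _ d := Measure.copy (@sphere_measure d)
  (mscale (d.+1%:R)%:nng
    (measure_function_pushforward__canonical__measure_function_Measure
      (mrestr (lebesgue_rV d.+1) (@measurable_punctured_ball d))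
      (@measurable_radial d))).

End sphere.
Arguments sphere {R} d.
Arguments punctured_ball {R} d.
Arguments sphere_measure {R} d A.

(* Functions on the sphere are represented by functions on the ambient space;
   only their values on the sphere matter in the notions below, the nodes [x] of
   the quadrature rule being points of the sphere. *)
Section functions_on_the_sphere.
Context {R : realType} (d : nat).
Implicit Types (f g : 'rV[R]_d.+1 -> R) (p : {mpoly R[d.+1]}).

Definition sphere_int f : R := \int[sphere_measure d]_(x in sphere d) f x.

Definition L2norm f : R := Num.sqrt (sphere_int (fun x => f x ^+ 2)).

Definition unif_norm f : R := sup [set `|f x| | x in sphere d].

Definition restricts p f :=
  forall x, sphere d x -> f x = p.@[x ord0].

(* [msize p] is one more than the total degree of [p], and [msize 0 = 0] *)
Definition poly_space (n : nat) : set ('rV[R]_d.+1 -> R) :=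
  [set f | exists2 p, (msize p <= n.+1)%N & restricts p f].

Definition laplacian p : {mpoly R[d.+1]} :=
  \sum_(i < d.+1) p^`M(i)^`M(i).

Definition harmonics (l : nat) : set ('rV[R]_d.+1 -> R) :=
  [set f | exists p,
    [/\ p \is l.-homog, laplacian p = 0 & restricts p f]].

Definition orthonormal_basis (V : set ('rV[R]_d.+1 -> R)) (N : nat)
    (Y : 'I_N -> 'rV[R]_d.+1 -> R) :=
  [/\ forall k, V (Y k),
      forall k k', sphere_int (fun x => Y k x * Y k' x) = (k == k')%:R
    & forall g, V g -> exists c : 'I_N -> R,
        forall x, sphere d x -> g x = \sum_(k < N) c k * Y k x].

Definition best_error (n : nat) f : R :=
  inf [set unif_norm (f \- g) | g in poly_space n].

Section hyperinterpolation.
Variables (m : nat) (x : 'I_m -> 'rV[R]_d.+1) (w : 'I_m -> R).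

Definition discrete_dot f g : R := \sum_(j < m) w j * f (x j) * g (x j).

Definition MZ_property (n : nat) (eta : R) :=
  forall chi, poly_space n chi ->
    `|\sum_(j < m) w j * chi (x j) ^+ 2 - sphere_int (fun y => chi y ^+ 2)|
      <= eta * sphere_int (fun y => chi y ^+ 2).

Definition hyperinterpolant (Z : nat -> nat)
    (Y : forall l, 'I_(Z l) -> 'rV[R]_d.+1 -> R) (n : nat) f :
    'rV[R]_d.+1 -> R :=
  fun y => \sum_(l < n.+1) \sum_(k < Z l) discrete_dot f (Y l k) * Y l k y.

End hyperinterpolation.
End functions_on_the_sphere.

(* Main.v *)
Require Import Defs.
From HB Require Import structures.
From mathcomp Require Import all_boot all_order all_algebra.
From mathcomp Require Import mpoly.
From mathcomp Require Import ring lra.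
From mathcomp Require Import all_classical all_reals all_analysis.
From mathcomp Require Import measurable_realfun.

Set Implicit Arguments.
Unset Strict Implicit.
Unset Printing Implicit Defensive.

Import Order.TTheory GRing.Theory Num.Theory.
Import numFieldNormedType.Exports.

Local Open Scope classical_set_scope.
Local Open Scope ring_scope.

(** On the sphere every polynomial is a sum of harmonic ones, because the
    Laplacian maps [r^2 p], with [p] homogeneous, onto all homogeneous
    polynomials. Harmonics of different degrees are orthogonal by the divergence
    theorem, which follows from the rotation invariance of the surface measure;
    the latter holds because a plane rotation is a product of three shears and
    Lebesgue measure is invariant under shears by Fubini's theorem. So the [Y_lk]
    are an orthonormal basis of the polynomials of degree at most [n], and
    [U_n f] is the polynomial [u] with [int u p = <f, p>_m] for all such [p].
    With [p = u], positivity of [sum_j w_j ((1 + eta) f - u)^2] and the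
    Marcinkiewicz-Zygmund property give [|u|^2 <= (1 + eta) <f, f>_m]. For a
    polynomial [chi], [int (U chi) chi = <chi, chi>_m] leads to
    [|U chi - chi|^2 <= ((1 + eta)^2 - 2 (1 - eta) + 1) |chi|^2]. The error bound
    is the triangle inequality applied to
    [U f - f = U (f - chi) + (U chi - chi) - (f - chi)]. *)

(** * Harmonic decomposition of polynomials *)

Section polynomial_laplacian.
Context {R : realType} (d : nat).
Implicit Types p q : {mpoly R[d.+1]}.

Lemma mderivXi i j : ('X_i)^`M(j) = (i == j)%:R :> {mpoly R[d.+1]}.
Proof.
rewrite mderivX mnm1E; case: eqVneq => [->|_]; last by rewrite scale0r.
rewrite scale1r (_ : (U_(j) - U_(j))%MM = 0%MM) ?mpolyX0//.
by apply/mnmP => k; rewrite mnmBE mnm0E subnn.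
Qed.

Lemma mderiv_dhomog i l p : p \is l.+1.-homog -> p^`M(i) \is l.-homog.
Proof.
move=> /dhomogP hp; rewrite (mpolyE p) raddf_sum /= big_seq rpred_sum// => u up.
rewrite mderivZ mderivX; apply: dhomogZ.
(* Subtraction of multi-indices truncates, so the degree drops only when [u i] is positive;
   otherwise the coefficient [u i] kills the term. *)
have [ui|ui] := eqVneq (u i) 0%N; first by rewrite ui scale0r dhomog0.
apply: dhomogZ; rewrite dhomogX; apply/eqP.
have: mdeg (u - U_(i) + U_(i))%MM = l.+1.
  rewrite submK ?lep1mP//; exact: hp.
by rewrite mdegD mdeg1 addn1 => -[].
Qed.

Lemma mderiv_0homog i p : p \is 0.-homog -> p^`M(i) = 0.
Proof.
move=> /dhomogP hp; rewrite (mpolyE p) raddf_sum /= big_seq big1// => u up.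
have /eqP := hp _ up; rewrite mdeg_eq0 => /eqP ->.
by rewrite mpolyX0 mderivZ -mpolyC1 mderivC scaler0.
Qed.

Lemma euler_homogeneous l p : p \is l.-homog ->
  \sum_(i < d.+1) 'X_i * p^`M(i) = l%:R *: p.
Proof.
move=> /dhomogP hp.
rewrite (eq_bigr (fun i => \sum_(u <- msupp p) (p@_u * (u i)%:R) *: 'X_[u])).
  transitivity (\sum_(u <- msupp p) l%:R *: (p@_u *: 'X_[u])).
    2: by rewrite -scaler_sumr -mpolyE.
  rewrite exchange_big /= !big_seq; apply: eq_bigr => u up.
  rewrite -scaler_suml -mulr_sumr -natr_sum.
  by rewrite scalerA mulrC -mdegE (hp _ up).
move=> i _; rewrite {1}(mpolyE p) raddf_sum /= mulr_sumr; apply: eq_bigr => u _.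
rewrite mderivZ mderivX scalerA -scalerAr.
have [ui|ui] := eqVneq (u i) 0%N; first by rewrite ui mulr0 !scale0r.
by rewrite -mpolyXD addmC submK ?lep1mP.
Qed.

Lemma laplacian_is_linear : linear (@laplacian R d).
Proof.
move=> c p q; rewrite /laplacian scaler_sumr -big_split; apply: eq_bigr => i _.
by rewrite !linearP.
Qed.

HB.instance Definition _ := GRing.isLinear.Build R {mpoly R[d.+1]}
  {mpoly R[d.+1]} _ (@laplacian R d) laplacian_is_linear.

Lemma laplacianM p q : laplacian (p * q) =
  laplacian p * q + 2 *: \sum_(i < d.+1) p^`M(i) * q^`M(i) + p * laplacian q.
Proof.
rewrite /laplacian mulr_suml mulr_sumr scaler_sumr -!big_split /=.
apply: eq_bigr => i _; rewrite mderivM mderivD !mderivM.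
by rewrite scaler_nat; ring.
Qed.

Lemma laplacian_dhomog l p : p \is l.+2.-homog -> laplacian p \is l.-homog.
Proof.
by move=> hp; apply: rpred_sum => i _; do 2!apply: mderiv_dhomog.
Qed.

Lemma laplacian_dhomog_le1 l p : (l <= 1)%N -> p \is l.-homog ->
  laplacian p = 0.
Proof.
move=> l1 hp; rewrite /laplacian big1// => i _.
case: l l1 hp => [_ hp|[_ hp|//]]; first by rewrite (mderiv_0homog _ hp) mderiv0.
exact/mderiv_0homog/mderiv_dhomog.
Qed.

Definition rsq : {mpoly R[d.+1]} := \sum_(i < d.+1) 'X_i ^+ 2.

Lemma mderiv_rsq i : rsq^`M(i) = 2 *: 'X_i.
Proof.
rewrite /rsq raddf_sum /= (bigD1 i)//= big1 => [|j ji].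
  by rewrite expr2 mderivM mderivXi eqxx mulr1 mul1r addr0 scaler_nat mulr2n.
by rewrite expr2 mderivM mderivXi (negbTE ji) mulr0 mul0r addr0.
Qed.

Lemma rsq_dhomog : rsq \is 2.-homog.
Proof.
apply: rpred_sum => i _; rewrite expr2.
by apply: (@dhomogM _ _ _ 1%N _ 1%N); rewrite dhomogX; apply/eqP; exact: mdeg1.
Qed.

Lemma laplacian_rsq : laplacian rsq = (2 * d.+1%:R)%:MP.
Proof.
rewrite /laplacian (eq_bigr (fun=> 2%:MP)) => [|i _].
  by rewrite sumr_const card_ord mulr_natr !raddfMn.
by rewrite mderiv_rsq mderivZ mderivXi eqxx -mul_mpolyC mulr1.
Qed.

Lemma laplacian_rsqM l p : p \is l.-homog ->
  laplacian (rsq * p) = (2 * d.+1%:R + 4 * l%:R) *: p + rsq * laplacian p.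
Proof.
move=> hp; rewrite laplacianM laplacian_rsq; congr (_ + _).
rewrite (eq_bigr (fun i => 2 *: ('X_i * p^`M(i)))) => [|i _]; last first.
  by rewrite mderiv_rsq scalerAl.
rewrite -scaler_sumr (euler_homogeneous hp) mul_mpolyC !scalerA -scalerDl.
by congr (_ *: _); lra.
Qed.

(** Induction on [j], applying the case of one factor [rsq] to the homogeneous polynomial
    [rsq ^+ j.+1 * p] of degree [2 * j.+1 + l]. Of the constant only the sign matters, since it will
    be inverted. *)
Lemma laplacian_rsqXM l p : p \is l.-homog -> forall j, exists2 c : R, 0 < c &
  laplacian (rsq ^+ j.+1 * p) = c *: (rsq ^+ j * p) + rsq ^+ j.+1 * laplacian p.
Proof.
move=> hp; elim=> [|j [c c0 IH]].
  exists (2 * d.+1%:R + 4 * l%:R); last by rewrite expr1 (laplacian_rsqM hp) expr0 mul1r.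
  by rewrite ltr_wpDr// ?mulr_ge0// mulr_gt0.
exists (2 * d.+1%:R + 4 * (2 * j.+1 + l)%N%:R + c).
  by rewrite ltr_wpDl// addr_ge0// mulr_ge0.
have hq : rsq ^+ j.+1 * p \is (2 * j.+1 + l).-homog.
  by apply: dhomogM => //; apply: dhomogMn; exact: rsq_dhomog.
rewrite exprS -mulrA (laplacian_rsqM hq) IH mulrDr -!scalerAr !mulrA -exprS.
by rewrite addrA -exprS -scalerDl.
Qed.

(** The first guess [c^-1 *: p] leaves the error [c^-1 *: (rsq ^+ j.+1 * laplacian p)]. It has the
    same shape with the degree lowered by two and the exponent raised by one, so strong induction on
    [l], for all [j] at once, removes it. In degree at most one there is no error. *)
Lemma laplacian_rsqX_onto l p j : p \is l.-homog -> exists2 q, q \is l.-homog &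
  laplacian (rsq ^+ j.+1 * q) = rsq ^+ j * p.
Proof.
elim/ltn_ind: l p j => l IH p j hp.
have [c c0 hc] := laplacian_rsqXM hp j.
have hcp : c^-1 *: p \is l.-homog by exact: dhomogZ.
have [l1|l1] := leqP l 1.
  exists (c^-1 *: p) => //.
  rewrite -scalerAr linearZ /= hc (laplacian_dhomog_le1 l1 hp) mulr0 addr0.
  by rewrite scalerA mulVf ?scale1r// gt_eqF.
case: l l1 IH hp hcp => [//|[//|l]] _ IH hp hcp.
have hlp : - c^-1 *: laplacian p \is l.-homog by apply/dhomogZ/laplacian_dhomog.
have [q hq lq] := IH l (ltnW (ltnSn _)) _ j.+1 hlp.
exists (c^-1 *: p + rsq * q).
  by apply: rpredD => //; rewrite -[l.+2]/(2 + l)%N dhomogM ?rsq_dhomog.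
rewrite mulrDr mulrA -exprSr linearD /= lq -!scalerAr linearZ /= hc.
rewrite scalerDr scalerA mulVf ?gt_eqF// scale1r -addrA.
by rewrite scaleNr subrr addr0.
Qed.

Lemma harmonic_decomposition l p : p \is l.+2.-homog -> exists2 q,
  q \is l.-homog & laplacian (p - rsq * q) = 0.
Proof.
move=> /laplacian_dhomog/(laplacian_rsqX_onto 0)[q hq]; rewrite expr1 expr0 mul1r.
by move=> lq; exists q => //; rewrite linearB /= lq subrr.
Qed.

Lemma meval_rsq (x : 'rV[R]_d.+1) : sphere d x -> rsq.@[x ord0] = 1.
Proof.
move=> sx; rewrite /rsq raddf_sum /=.
under eq_bigr do rewrite rmorphXn /= mevalXU.
by rewrite -(sqr_sqrtr (sumr_ge0 _ (fun i _ => sqr_ge0 _))) -/(enorm x) sx expr1n.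
Qed.

End polynomial_laplacian.

(** * Shears and Lebesgue measure *)

Section shear_invariance.
Context {R : realType}.

(** The translated measure gives half-open intervals their length, which characterises Lebesgue
    measure. *)
Lemma lebesgue_measure_shift (c : R) (A : set (measurableTypeR R)) : measurable A ->
  lebesgue_measure ((fun x => x + c) @^-1` A) = lebesgue_measure A.
Proof.
move=> mA.
have mc : measurable_fun [set: measurableTypeR R]
    (fun x : R => x + c : measurableTypeR R).
  by apply: measurable_funD => //; exact: measurable_cst.
apply/esym.
apply: (@lebesgue_measure_unique R
    (measure_function_pushforward__canonical__measure_function_Measure
      lebesgue_measure mc)) => //= _ [[a b]] _ <-.
rewrite /pushforward.
rewrite (_ : _ @^-1` _ = `]a - c, b - c]%classic); last first.
  by apply/seteqP; split=> x /=; rewrite !in_itv /= ltrBlDr lerBrDr.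
rewrite !lebesgue_measure_itv/= !lte_fin ltrD2r.
by case: ifP => // _; rewrite -!EFinB; congr (_%:E); ring.
Qed.

(** A genuine shear only when [phi] ignores coordinate [i]; this is what [indep_of_coord]
    expresses. *)
Definition shear n (i : 'I_n) (phi : 'rV[R]_n -> R) (x : 'rV[R]_n) : 'rV[R]_n :=
  \row_j (x ord0 j + (j == i)%:R * phi x).

Definition indep_of_coord n (i : 'I_n) (phi : 'rV[R]_n -> R) :=
  forall x y : 'rV[R]_n, (forall j, j != i -> x ord0 j = y ord0 j) -> phi x = phi y.

Lemma measurable_shear n (i : 'I_n) phi :
  measurable_fun [set: 'rV[R]_n] phi ->
  measurable_fun [set: 'rV[R]_n] (shear i phi).
Proof.
move=> mphi; apply: measurable_fun_rV => j.
rewrite (_ : (fun _ => _) = fun x : 'rV[R]_n => x ord0 j + (j == i)%:R * phi x); last first.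
  by apply/funext => x; rewrite mxE.
apply: measurable_funD; first exact: measurable_rV_coord.
by apply: measurable_funM => //; exact: measurable_cst.
Qed.

Lemma shear_rV_cons0 n phi (a : R) (v : 'rV[R]_n) :
  shear ord0 phi (rV_cons (a, v)) = rV_cons (a + phi (rV_cons (a, v)), v).
Proof.
apply/rowP => j; rewrite mxE.
case: (unliftP ord0 j) => [k ->|->]; last by rewrite !rV_cons0 eqxx mul1r.
by rewrite !rV_consS eq_sym (negbTE (neq_lift _ _)) mul0r addr0.
Qed.

Lemma shear_rV_consS n (i : 'I_n) phi (a : R) (v : 'rV[R]_n) :
  shear (lift ord0 i) phi (rV_cons (a, v)) =
  rV_cons (a, shear i (fun u => phi (rV_cons (a, u))) v).
Proof.
apply/rowP => j; rewrite mxE.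
case: (unliftP ord0 j) => [k ->|->].
  by rewrite !rV_consS mxE (inj_eq lift_inj).
by rewrite !rV_cons0 (negbTE (neq_lift _ _)) mul0r addr0.
Qed.

Lemma lebesgue_rVSE n (A : set 'rV[R]_n.+1) :
  lebesgue_rV n.+1 A =
  (lebesgue_measure \x lebesgue_rV n)%E (@rV_cons R n @^-1` A).
Proof. by []. Qed.

Lemma measurable_rV_consr n (a : R) :
  measurable_fun [set: 'rV[R]_n] (fun v => rV_cons (a, v)).
Proof.
apply: (measurableT_comp (@measurable_rV_cons R n)).
exact: pair1_measurable.
Qed.

(** Tonelli for sets: both iterated measures agree on rectangles, so uniqueness of the product
    measure applies. *)
Lemma product_measure12 n (A : set (measurableTypeR R * 'rV[R]_n)) : measurable A ->
  (lebesgue_measure \x lebesgue_rV n)%E A = (lebesgue_measure \x^ lebesgue_rV n)%E A.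
Proof.
move=> mA; apply: product_measure_unique => // B C mB mC.
exact: product_measure2E.
Qed.

(** Induction on the dimension by slicing. If the sheared coordinate is the first one, the slices
    with the other coordinates fixed are merely translated. Otherwise the slices with the first
    coordinate fixed undergo a shear in one dimension less. *)
Lemma lebesgue_rV_shear n (i : 'I_n) (phi : 'rV[R]_n -> R) :
  measurable_fun [set: 'rV[R]_n] phi -> indep_of_coord i phi ->
  forall A, measurable A ->
    lebesgue_rV n (shear i phi @^-1` A) = lebesgue_rV n A.
Proof.
elim: n i phi => [[]//|n IH] i phi mphi iphi A mA.
have mB : measurable (@rV_cons R n @^-1` A).
  by rewrite -[X in measurable X]setTI; exact: measurable_rV_cons.
have mC : measurable (@rV_cons R n @^-1` (shear i phi @^-1` A)).
  rewrite -[X in measurable X]setTI; apply: measurable_rV_cons => //.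
  by rewrite -[X in measurable X]setTI; exact: measurable_shear.
case: (unliftP ord0 i) => [k ik|i0]; last first.
- subst i; rewrite !lebesgue_rVSE.
  (* The order of integration is exchanged so that the inner measure is the one over the first
     coordinate. *)
  rewrite !product_measure12//; apply: eq_integral => v _ /=.
  have phi0 a : phi (rV_cons (a, v)) = phi (rV_cons (0, v)).
    apply: iphi => j; case: (unliftP ord0 j) => [l -> _|->]; last by rewrite eqxx.
    by rewrite !rV_consS.
  rewrite -[RHS](lebesgue_measure_shift (phi (rV_cons (0, v)))); last first.
    exact: measurable_ysection.
  congr lebesgue_measure; apply/seteqP.
  by split => a; rewrite /= !ysectionE /= shear_rV_cons0 !phi0.
subst i; rewrite !lebesgue_rVSE /product_measure1; apply: eq_integral => a _ /=.
rewrite -[RHS](IH k (fun u => phi (rV_cons (a, u)))).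
- by congr (_ _); apply/seteqP; split => v; rewrite /= !xsectionE /= shear_rV_consS.
- exact: (measurableT_comp mphi (@measurable_rV_consr n a)).
- move=> u v uv; apply: iphi => j.
  case: (unliftP ord0 j) => [l ->|-> _]; last by rewrite !rV_cons0.
  by rewrite (inj_eq lift_inj) !rV_consS => /uv.
- exact: measurable_xsection.
Qed.

(** This makes the surface measure finite: the punctured unit ball lies in the cube with [c = 1]. *)
Lemma lebesgue_rV_cube n (c : R) :
  (lebesgue_rV n [set x : 'rV[R]_n | (forall i, `|x ord0 i| <= c)%R] < +oo)%E.
Proof.
elim: n => [|n IH].
  by rewrite /= diracE; case: (_ \in _); rewrite ltry.
rewrite lebesgue_rVSE.
have mcube : measurable [set x : 'rV[R]_n | forall i, `|x ord0 i| <= c].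
  rewrite (_ : mkset _ = \bigcap_(i in [set: 'I_n])
     ((fun x : 'rV[R]_n => x ord0 i) @^-1` `[-c, c])).
    apply: fin_bigcap_measurable => // i _.
    by rewrite -[X in measurable X]setTI; exact: measurable_rV_coord.
  apply/seteqP; split => x /= h i; first by move=> _; rewrite /= in_itv /= -ler_norml.
  by have := h i I; rewrite /= in_itv /= -ler_norml.
rewrite (_ : _ @^-1` _ = `[- c, c]%classic `*`
    [set x : 'rV[R]_n | forall i, `|x ord0 i| <= c]); last first.
  apply/seteqP; split => -[a v] /=.
    move=> h; split; first by have := h ord0; rewrite rV_cons0 in_itv /= -ler_norml.
    by move=> i; have := h (lift ord0 i); rewrite rV_consS.
  rewrite in_itv /= -ler_norml => -[ha hv] i.
  by case: (unliftP ord0 i) => [j ->|->]; rewrite ?rV_consS ?rV_cons0.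
have mI : measurable (`[- c, c]%classic : set (measurableTypeR R)) by [].
rewrite product_measure1E// [X in (X * _)%E](@lebesgue_measure_itv R `[- c, c]) /=.
rewrite lte_fin; apply: lte_mul_pinfty => //; last by case: ifP.
by case: ifPn => // cc; rewrite -EFinB lee_fin; lra.
Qed.

End shear_invariance.

(** * Rotation invariance of the surface measure *)

Section rotation_invariance.
Context {R : realType} (d : nat).
Implicit Types (A : set 'rV[R]_d.+1) (x : 'rV[R]_d.+1) (p : {mpoly R[d.+1]}).

Lemma measurable_sphere : measurable (@sphere R d).
Proof.
rewrite (_ : @sphere R d = @enorm R d.+1 @^-1` [set 1]); last by [].
by rewrite -[X in measurable X]setTI; exact: measurable_enorm.
Qed.

Lemma enorm_coord n (x : 'rV[R]_n) i : `|x ord0 i| <= enorm x.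
Proof.
rewrite -sqrtr_sqr ler_wsqrtr// (bigD1 i)//= lerDl sumr_ge0// => j _.
exact: sqr_ge0.
Qed.

Lemma sphere_measure_fin A : measurable A -> (sphere_measure d A < +oo)%E.
Proof.
move=> mA; rewrite /sphere_measure lte_mul_pinfty ?lee_fin//.
apply: le_lt_trans (lebesgue_rV_cube d.+1 1).
apply: le_measure; rewrite ?inE.
- apply: measurableI; last exact: measurable_punctured_ball.
  by rewrite -[X in measurable X]setTI; exact: measurable_radial.
- rewrite (_ : mkset _ = \bigcap_(i in [set: 'I_d.+1])
     ((fun x : 'rV[R]_d.+1 => x ord0 i) @^-1` `[-1, 1])).
    apply: fin_bigcap_measurable => // i _.
    by rewrite -[X in measurable X]setTI; exact: measurable_rV_coord.
  apply/seteqP; split => x /= h i; first by move=> _; rewrite /= in_itv /= -ler_norml.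
  by have := h i I; rewrite /= in_itv /= -ler_norml.
- by move=> x /= [_ /andP[_ x1]] i; exact: le_trans (enorm_coord x i) x1.
Qed.

(** The rotation by the angle [theta] with [t = tan (theta / 2)]. The rational parametrisation of
    cosine and sine reduces all identities to field arithmetic. *)
Definition rotation (i j : 'I_d.+1) (t : R) x : 'rV[R]_d.+1 :=
  let c := (1 - t ^+ 2) / (1 + t ^+ 2) in let s := 2 * t / (1 + t ^+ 2) in
  \row_k (if k == i then c * x ord0 i - s * x ord0 j
          else if k == j then s * x ord0 i + c * x ord0 j else x ord0 k).

Let D0 (t : R) : 1 + t ^+ 2 != 0.
Proof. by rewrite gt_eqF// ltr_pwDl// sqr_ge0. Qed.

(** The classical three-shear factorisation, with parameters [- tan (theta / 2)], [sin theta] and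
    [- tan (theta / 2)]. *)
Lemma rotation_shear i j t : i != j -> rotation i j t =
  shear i (fun x => - t * x ord0 j) \o
  shear j (fun x => 2 * t / (1 + t ^+ 2) * x ord0 i) \o
  shear i (fun x => - t * x ord0 j).
Proof.
move=> ij; have ji : (j == i) = false by rewrite eq_sym (negbTE ij).
apply/funext => x /=; apply/rowP => k; rewrite /rotation !mxE.
have [->|ki] := eqVneq k i.
  by rewrite ?eqxx ?ji ?(negbTE ij) /=; field; exact: D0.
have [->|kj] := eqVneq k j.
  by rewrite ?eqxx ?ji ?(negbTE ij) /=; field; exact: D0.
by rewrite ?(negbTE ki) ?(negbTE kj) !mul0r !addr0.
Qed.

Lemma measurable_rotation i j t : measurable_fun [set: 'rV[R]_d.+1] (rotation i j t).
Proof.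
apply: measurable_fun_rV => k; rewrite /rotation.
under eq_fun do rewrite mxE.
case: (k == i); [|case: (k == j)]; last exact: measurable_rV_coord.
- apply: measurable_funB; apply: measurable_funM => //; exact: measurable_rV_coord.
- apply: measurable_funD; apply: measurable_funM => //; exact: measurable_rV_coord.
Qed.

Lemma enorm_rotation i j t x : i != j -> enorm (rotation i j t x) = enorm x.
Proof.
move=> ij; congr Num.sqrt; rewrite (bigD1 i)// (bigD1 j) 1?eq_sym//=.
rewrite [RHS](bigD1 i)// [X in _ = _ + X](bigD1 j) 1?eq_sym//= !addrA.
congr (_ + _); last first.
  by apply: eq_bigr => k /andP[ki kj]; rewrite mxE (negbTE ki) (negbTE kj).
by rewrite !mxE !eqxx eq_sym (negbTE ij); field; exact: D0.
Qed.

Lemma radial_rotation i j t x : i != j ->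
  radial (rotation i j t x) = rotation i j t (radial x).
Proof.
move=> ij; rewrite /radial enorm_rotation//; apply/rowP => k; rewrite !mxE.
by case: ifP => _; [|case: ifP => _ //]; ring.
Qed.

Lemma lebesgue_rV_rotation i j t A : i != j -> measurable A ->
  lebesgue_rV d.+1 (rotation i j t @^-1` A) = lebesgue_rV d.+1 A.
Proof.
move=> ij mA; rewrite rotation_shear//.
have mphi (u : R) k : measurable_fun [set: 'rV[R]_d.+1] (fun x : 'rV[R]_d.+1 => u * x ord0 k).
  by apply: measurable_funM => //; exact: measurable_rV_coord.
have pre (T : 'rV[R]_d.+1 -> 'rV[R]_d.+1) B :
    measurable_fun [set: 'rV[R]_d.+1] T -> measurable B -> measurable (T @^-1` B).
  by move=> mT mB; rewrite -[X in measurable X]setTI; exact: mT.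
have indep (u : R) k l : k != l -> indep_of_coord k (fun x : 'rV[R]_d.+1 => u * x ord0 l).
  by move=> kl x y xy; rewrite xy// eq_sym.
set u1 := - t; set u2 := 2 * t / (1 + t ^+ 2).
have m1 := measurable_shear i (mphi u1 j).
have m2 := measurable_shear j (mphi u2 i).
have ji : j != i by rewrite eq_sym.
have s1 := lebesgue_rV_shear (mphi u1 j) (indep u1 _ _ ij).
have s2 := lebesgue_rV_shear (mphi u2 i) (indep u2 _ _ ji).
move: m1 m2 s1 s2; move: (shear i _) (shear j _) => S1 S2 m1 m2 s1 s2.
transitivity (lebesgue_rV d.+1 (S1 @^-1` (S2 @^-1` (S1 @^-1` A)))); first by [].
rewrite (s1 _ (pre _ _ m2 (pre _ _ m1 mA))) (s2 _ (pre _ _ m1 mA)).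
exact: s1.
Qed.

(** A rotation commutes with the radial projection and preserves the punctured ball, so the cone
    over the preimage of [A] is the preimage of the cone over [A]. *)
Lemma sphere_measure_rotation i j t A : i != j -> measurable A ->
  sphere_measure d (rotation i j t @^-1` A) = sphere_measure d A.
Proof.
move=> ij mA; rewrite /sphere_measure; congr (_ * _)%E.
rewrite -[RHS](lebesgue_rV_rotation t ij); last first.
  apply: measurableI; last exact: measurable_punctured_ball.
  by rewrite -[X in measurable X]setTI; exact: measurable_radial.
congr (_ _); apply/seteqP; split => x /=;
  by rewrite radial_rotation// /punctured_ball /= enorm_rotation.
Qed.

End rotation_invariance.

(** * Integrals of polynomials over the sphere *)

Section polynomial_integrals.
Context {R : realType} (d : nat).
Implicit Types (x : 'rV[R]_d.+1) (p q : {mpoly R[d.+1]}).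

(** This suits properties compatible with evaluation: measurability, boundedness, continuity and the
    expansion along a rotation. *)
Lemma mpoly_ring_ind (P : {mpoly R[d.+1]} -> Prop) :
  (forall c, P c%:MP) -> (forall i, P 'X_i) ->
  (forall p q, P p -> P q -> P (p + q)) ->
  (forall p q, P p -> P q -> P (p * q)) -> forall p, P p.
Proof.
move=> PC PX PD PM p; rewrite (mpolyE p); apply: (big_ind P) => //.
  by rewrite -mpolyC0; exact: PC.
move=> u _; rewrite -mul_mpolyC; apply: (PM); first exact: PC.
rewrite mpolyXE_id; apply: (big_ind P); [exact: PC|exact: PM|].
move=> i _; move: (u i) => e; elim: e => [|k IH]; first by rewrite expr0 -mpolyC1; exact: PC.
by rewrite exprS; exact: PM.
Qed.

Lemma measurable_meval p :
  measurable_fun [set: 'rV[R]_d.+1] (fun x : 'rV[R]_d.+1 => p.@[x ord0]).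
Proof.
elim/mpoly_ring_ind: p => [c|i|p q mp mq|p q mp mq].
- by under eq_fun do rewrite mevalC; exact: measurable_cst.
- by under eq_fun do rewrite mevalXU; exact: measurable_rV_coord.
- by under eq_fun do rewrite mevalD; exact: measurable_funD.
- by under eq_fun do rewrite mevalM; exact: measurable_funM.
Qed.

Lemma meval_sphere_bounded p :
  exists2 C : R, 0 <= C & forall x, sphere d x -> `|p.@[x ord0]| <= C.
Proof.
elim/mpoly_ring_ind: p => [c|i|p q [C C0 hC] [D D0 hD]|p q [C C0 hC] [D D0 hD]].
- by exists `|c| => // x _; rewrite mevalC.
- exists 1 => // x sx; rewrite mevalXU -(_ : enorm x = 1)//; exact: enorm_coord.
- exists (C + D) => [|x sx]; first exact: addr_ge0.
  by rewrite mevalD (le_trans (ler_normD _ _))// lerD// ?hC ?hD.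
- exists (C * D) => [|x sx]; first exact: mulr_ge0.
  by rewrite mevalM normrM ler_pM// ?hC ?hD.
Qed.

Lemma bounded_integrable_sphere (f : 'rV[R]_d.+1 -> R) (C : R) :
  measurable_fun (sphere d) f -> (forall x, sphere d x -> `|f x| <= C) ->
  (@sphere_measure R d).-integrable (sphere d) (EFin \o f).
Proof.
move=> mf fC; have mS := @measurable_sphere R d.
apply: (@measurable_bounded_integrable _ _ _ (sphere_measure d) f _ mS) => //.
- exact: (sphere_measure_fin mS).
- exists C; split; first exact: num_real.
  by move=> M CM x sx; exact: (le_trans (fC _ sx) (ltW CM)).
Qed.

Lemma meval_integrable p : (@sphere_measure R d).-integrable (sphere d)
  (EFin \o (fun x : 'rV[R]_d.+1 => p.@[x ord0])).
Proof.
have [C _ hC] := meval_sphere_bounded p.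
apply: (@bounded_integrable_sphere _ C) => //.
by apply: measurable_funTS; exact: measurable_meval.
Qed.

Definition poly_int p : R := sphere_int (fun x : 'rV[R]_d.+1 => p.@[x ord0]).

Lemma poly_int_is_linear : linear poly_int.
Proof.
move=> c p q; rewrite /poly_int /sphere_int.
under eq_Rintegral do rewrite mevalD mevalZ.
have mS := @measurable_sphere R d.
rewrite RintegralD//; [|have := meval_integrable (c *: p)|exact: meval_integrable].
  by rewrite RintegralZl//; exact: meval_integrable.
by under eq_fun do rewrite mevalZ.
Qed.

HB.instance Definition _ := GRing.isLinear.Build R {mpoly R[d.+1]} R _
  poly_int poly_int_is_linear.

Lemma eq_sphere_int (f g : 'rV[R]_d.+1 -> R) :
  (forall x, sphere d x -> f x = g x) -> sphere_int f = sphere_int g.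
Proof. by move=> fg; apply: eq_Rintegral => x; rewrite inE => /fg. Qed.

Lemma sphere_int_ge0 (f : 'rV[R]_d.+1 -> R) :
  (forall x, sphere d x -> 0 <= f x) -> 0 <= sphere_int f.
Proof. exact: Rintegral_ge0. Qed.

Lemma poly_int_eq p q : (forall x, sphere d x -> p.@[x ord0] = q.@[x ord0]) ->
  poly_int p = poly_int q.
Proof. exact: eq_sphere_int. Qed.

Lemma poly_int_rsqM p : poly_int (rsq d * p) = poly_int p.
Proof. by apply: poly_int_eq => x sx; rewrite mevalM meval_rsq// mul1r. Qed.

Lemma sphere_rotation i j t x : i != j ->
  sphere d (rotation i j t x) <-> sphere d x.
Proof. by move=> ij; rewrite /sphere /= enorm_rotation. Qed.

Lemma meval_rotation_integrable i j t p : i != j ->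
  (@sphere_measure R d).-integrable (sphere d)
    (EFin \o (fun x => p.@[rotation i j t x ord0])).
Proof.
move=> ij; have [C _ hC] := meval_sphere_bounded p.
apply: (@bounded_integrable_sphere _ C).
  apply: measurable_funTS.
  exact: (measurableT_comp (measurable_meval p) (measurable_rotation i j t)).
by move=> x sx; apply: hC; apply/sphere_rotation.
Qed.

Lemma poly_int_rotation i j t p : i != j ->
  sphere_int (fun x => p.@[rotation i j t x ord0]) = poly_int p.
Proof.
move=> ij; rewrite /poly_int /sphere_int /Rintegral; congr fine.
have mS := @measurable_sphere R d.
have mrot := @measurable_rotation R d i j t.
have rotS : rotation i j t @^-1` sphere d = sphere d.
  by apply/seteqP; split => x /=; move/(sphere_rotation t x ij).
transitivity (\int[pushforward (sphere_measure d) (rotation i j t)]_(x in sphere d)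
    (p.@[x ord0])%:E)%E.
  have mp : measurable_fun [set: 'rV[R]_d.+1] (fun x => (p.@[x ord0])%:E).
    by apply/measurable_EFinP; exact: measurable_meval.
  rewrite (integral_pushforward mrot mp _ mS) rotS//.
  exact: meval_rotation_integrable.
apply: eq_measure_integral => A mA _; exact: sphere_measure_rotation.
Qed.

(** The infinitesimal generator of the rotations in the plane of coordinates [i] and [j]. *)
Definition angular_deriv (i j : 'I_d.+1) p := 'X_i * p^`M(j) - 'X_j * p^`M(i).

(** First-order expansion at [t = 0] with a remainder uniform on the sphere. The factor [2] appears
    because the angle is [2 * arctan t]. *)
Lemma rotation_taylor i j p : i != j -> exists2 C : R, 0 <= C &
  forall (t : R) x, 0 < t <= 1 -> sphere d x ->
    `|p.@[rotation i j t x ord0] - p.@[x ord0] -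
      2 * t * (angular_deriv i j p).@[x ord0]| <= C * t ^+ 2.
Proof.
move=> ij; have ji : (j == i) = false by rewrite eq_sym (negbTE ij).
elim/mpoly_ring_ind: p => [c|k|p q [C C0 hC] [D D0 hD]|p q [C C0 hC] [D D0 hD]].
- exists 0 => // t x _ _.
  rewrite /angular_deriv !mderivC !mulr0 subrr rmorph0 !mevalC.
  by rewrite subrr mulr0 subr0 normr0 mul0r.
- exists 4 => // t x /andP[t0 t1] sx.
  have xi : `|x ord0 i| <= 1 by rewrite -(_ : enorm x = 1)//; exact: enorm_coord.
  have xj : `|x ord0 j| <= 1 by rewrite -(_ : enorm x = 1)//; exact: enorm_coord.
  have D1 : 1 <= 1 + t ^+ 2 by rewrite lerDl sqr_ge0.
  have Dn0 : 1 + t ^+ 2 != 0 by rewrite gt_eqF// (lt_le_trans _ D1).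
  (* With [c] and [s] the cosine and sine, [c - 1 = - 2 t^2 / (1 + t^2)] and
     [s - 2 t = - 2 t^3 / (1 + t^2)]; so the remainder of a rotated coordinate is, up to sign, of
     the form bounded here. *)
  have bnd (y z : R) : `|y| <= 1 -> `|z| <= 1 ->
      `|t ^+ 2 / (1 + t ^+ 2) * (2 * (y + t * z))| <= 4 * t ^+ 2.
    move=> hy hz; rewrite normrM ger0_norm; last by rewrite divr_ge0 ?sqr_ge0// (le_trans _ D1).
    rewrite mulrC; apply: ler_pM => //; first by rewrite divr_ge0 ?sqr_ge0// (le_trans _ D1).
      rewrite normrM (ger0_norm (ler0n _ 2)) (_ : 4 = 2 * (1 + 1)); last by lra.
      rewrite ler_pM2l// (le_trans (ler_normD _ _))// lerD// normrM.
      by rewrite (ger0_norm (ltW t0)) -(mulr1 1) ler_pM// ltW.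
    by rewrite ler_pdivrMr ?(lt_le_trans _ D1)// ler_peMr// sqr_ge0.
  rewrite /angular_deriv !mderivXi mevalB !mevalM !mevalXU !rmorph_nat /=.
  rewrite mxE.
  have [->|ki] := eqVneq k i.
    rewrite (negbTE ij) /=.
    rewrite [X in `|X|](_ : _ = - (t ^+ 2 / (1 + t ^+ 2) * (2 * (x ord0 i + t * - x ord0 j)))).
      by rewrite normrN bnd// normrN.
    by field.
  have [->|kj] := eqVneq k j.
    rewrite /=.
    rewrite [X in `|X|](_ : _ = - (t ^+ 2 / (1 + t ^+ 2) * (2 * (x ord0 j + t * x ord0 i)))).
      by rewrite normrN bnd.
    by field.
  rewrite /= !mulr0 subrr subr0 mulr0 subrr normr0.
  by rewrite mulr_ge0// sqr_ge0.
- exists (C + D) => [|t x t01 sx]; first exact: addr_ge0.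
  rewrite [leRHS]mulrDl; move: (lerD (hC t x t01 sx) (hD t x t01 sx)).
  apply: le_trans; apply: le_trans (ler_normD _ _).
  rewrite le_eqVlt; apply/orP; left; apply/eqP; congr `|_|; rewrite /angular_deriv !mderivD.
  by rewrite !(mevalB, mevalD, mevalM, mevalXU); ring.
pose p1 := angular_deriv i j p; pose q1 := angular_deriv i j q.
have [P P0 hP] := meval_sphere_bounded p; have [Q Q0 hQ] := meval_sphere_bounded q.
have [P1 P10 hP1] := meval_sphere_bounded p1; have [Q1 Q10 hQ1] := meval_sphere_bounded q1.
exists (4 * (P1 * Q1) + C * Q + (P + 2 * P1) * D) => [|t x t01 sx].
  by rewrite !addr_ge0// !mulr_ge0// addr_ge0// mulr_ge0.
have := hC t x t01 sx; have := hD t x t01 sx.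
set ep := (X in `|X|) => hep; set eq := (X in `|X|) => heq.
set yt := rotation i j t x.
have qy : `|q.@[yt ord0]| <= Q by apply/hQ/sphere_rotation.
(* Here [eq] and [ep] are the remainders of [p] and [q]. The two expansions are multiplied, keeping
   [q] at the rotated point in the term with [eq]; since [angular_deriv] is a derivation, the terms
   linear in [t] cancel. *)
rewrite [X in `|X|](_ : _ = 4 * t ^+ 2 * (p1.@[x ord0] * q1.@[x ord0]) +
   eq * q.@[yt ord0] + (p.@[x ord0] + 2 * t * p1.@[x ord0]) * ep); last first.
  rewrite /ep /eq /p1 /q1 /angular_deriv -/yt !mderivM.
  by rewrite !(mevalB, mevalD, mevalM, mevalXU); ring.
have /andP[t0 t1] := t01; have t2 := sqr_ge0 t; have t0' := ltW t0.
have n2 : `|2 * t| <= 2 by rewrite ger0_norm ?mulr_ge0 ?(ltW t0)// ler_piMr.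
rewrite [leRHS]mulrDl (le_trans (ler_normD _ _))// lerD//.
  rewrite [leRHS]mulrDl (le_trans (ler_normD _ _))// lerD//.
    have n4 : `|4 * t ^+ 2| = 4 * t ^+ 2 by rewrite ger0_norm// mulr_ge0.
    rewrite normrM n4 [leRHS]mulrAC ler_wpM2l ?mulr_ge0//.
    by rewrite normrM ler_pM ?hP1 ?hQ1.
  by rewrite normrM mulrAC ler_pM.
rewrite normrM -[leRHS]mulrA ler_pM// (le_trans (ler_normD _ _))// lerD ?hP//.
by rewrite normrM ler_pM ?hP1.
Qed.

(** By rotation invariance, integrating the expansion leaves only the remainder:
    [2 t |I| <= C S t^2] for [0 < t <= 1], with [I] the integral in question and [S] the area of the
    sphere. Small [t] forces [I = 0]. *)
Lemma poly_int_angular_deriv i j p : poly_int (angular_deriv i j p) = 0.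
Proof.
have [->|ij] := eqVneq i j; first by rewrite /angular_deriv subrr raddf0.
have [C C0 hC] := rotation_taylor p ij.
have mS := @measurable_sphere R d.
pose S := poly_int 1; set I := poly_int _.
have S0 : 0 <= S by apply: sphere_int_ge0 => x _; rewrite meval1.
have key t : 0 < t <= 1 -> `|I| * 2 <= C * S * t.
  move=> t01; have /andP[t0 _] := t01.
  rewrite -(ler_pM2r t0) -[leRHS]mulrA -expr2.
  have iT := meval_rotation_integrable t p ij.
  have iL := meval_integrable (p + (2 * t) *: angular_deriv i j p).
  pose g x := p.@[rotation i j t x ord0] - (p + (2 * t) *: angular_deriv i j p).@[x ord0].
  have gE : sphere_int g = - (2 * t * I).
    rewrite /sphere_int RintegralB// -/(sphere_int _) -/(sphere_int _).
    rewrite poly_int_rotation// -/(poly_int _) linearD linearZ /= -/I.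
    by rewrite opprD addrA subrr add0r.
  have ig : (@sphere_measure R d).-integrable (sphere d) (EFin \o g).
    exact: (integrableB mS iT iL).
  have ic := meval_integrable (C * t ^+ 2)%:MP.
  rewrite (_ : `|I| * 2 * t = `|sphere_int g|); last first.
    by rewrite gE normrN !normrM (ger0_norm (ltW t0)) (ger0_norm (ler0n R 2)); ring.
  rewrite /sphere_int (le_trans (le_normr_Rintegral mS ig))//.
  rewrite (_ : C * S * t ^+ 2 = poly_int (C * t ^+ 2)%:MP); last first.
    by rewrite -[_%:MP]mulr1 mul_mpolyC linearZ /= -/S mulrAC.
  apply: le_Rintegral => //; first exact: (integrable_norm ig).
  move=> x sx; rewrite mevalC /g mevalD mevalZ opprD addrA; exact: hC.
apply/eqP; rewrite -normr_le0 leNgt; apply/negP => I0.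
have D0 : 0 < C * S + `|I| by rewrite ltr_wpDl// mulr_ge0.
(* This [t] lies in the admissible range even when [C * S] vanishes, and it satisfies
   [C * S * t <= |I|], against the lower bound [2 * |I|]. *)
have := key (`|I| / (C * S + `|I|)).
rewrite divr_gt0// ler_pdivrMr// mul1r lerDr mulr_ge0// => /(_ isT).
rewrite mulrA ler_pdivlMr// mulrC mulrA => h.
have CS0 : 0 <= C * S by exact: mulr_ge0.
have : 0 < `|I| * `|I| by exact: mulr_gt0.
have : 0 <= C * S * `|I| by rewrite mulr_ge0.
by move: h; nra.
Qed.


End polynomial_integrals.

(** * Orthogonality of spherical harmonics *)

Section harmonic_orthogonality.
Context {R : realType} (d : nat).
Implicit Types (p q : {mpoly R[d.+1]}) (g : 'I_d.+1 -> {mpoly R[d.+1]}).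

(* Each field [angular_deriv i j] integrates to zero; applied to [x_i g_j] and
   summed over all [i] and [j], this is the divergence theorem on the ball. *)
Lemma poly_int_divergence k g : (forall j, g j \is k.-homog) ->
  poly_int (\sum_(j < d.+1) (g j)^`M(j)) =
  (d + k)%:R * poly_int (\sum_(j < d.+1) 'X_j * g j).
Proof.
move=> hg.
(* The sum produces [d + 1] copies of [- 'X_j * g j], one of which cancels against the term [i = j];
   Euler's identity adds [k] more, whence [d + k]. *)
have E j : \sum_(i < d.+1) angular_deriv i j ('X_i * g j) =
    rsq d * (g j)^`M(j) - (d + k)%:R *: ('X_j * g j).
  rewrite (eq_bigr (fun i => 'X_i * (i == j)%:R * g j + 'X_i ^+ 2 * (g j)^`M(j)
      - ('X_j * g j) - 'X_j * ('X_i * (g j)^`M(i)))) => [|i _]; last first.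
    rewrite /angular_deriv !mderivM !mderivXi eqxx /=.
    by move: ((i == j)%:R) => e; ring.
  rewrite !big_split /= -mulr_suml sumrN sumr_const card_ord sumrN -mulr_sumr.
  rewrite (euler_homogeneous (hg j)) (bigD1 j)//= big1 => [|i ij]; last first.
    by rewrite (negbTE ij) mulr0.
  rewrite eqxx -mulr_suml -/(rsq d) natrD scalerDl -?scalerAr !scaler_nat mulrS /=.
  by move: ('X_j * g j *+ d) ('X_j * g j *+ k) => u v; ring.
have : poly_int (\sum_(j < d.+1) \sum_(i < d.+1) angular_deriv i j ('X_i * g j)) = 0.
  rewrite raddf_sum big1// => j _; rewrite raddf_sum big1// => i _.
  exact: poly_int_angular_deriv.
under eq_bigr do rewrite E.
rewrite big_split /= sumrN -mulr_sumr -scaler_sumr linearB linearZ /=.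
by rewrite poly_int_rsqM => /eqP; rewrite subr_eq0 => /eqP.
Qed.

Lemma mderiv_dhomog_mulr k l p q j : (0 < k + l)%N ->
  p \is k.-homog -> q \is l.-homog -> p * q^`M(j) \is (k + l).-1.-homog.
Proof.
case: l => [|l] ab hp hq; first by rewrite (mderiv_0homog _ hq) mulr0 dhomog0.
by rewrite addnS /=; apply: dhomogM => //; exact: mderiv_dhomog.
Qed.

(** Green's identity: the field [p grad q - q grad p] has divergence zero, and by Euler's identity
    its radial component is [(l - k) p q]. The resulting factor [(d + (k + l).-1) (l - k)] is
    nonzero. *)
Lemma poly_int_harmonic_orthogonal k l p q : (0 < d)%N -> k != l ->
  p \is k.-homog -> q \is l.-homog -> laplacian p = 0 -> laplacian q = 0 ->
  poly_int (p * q) = 0.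
Proof.
move=> d0 ab hp hq lp lq.
have ab0 : (0 < k + l)%N by case: k l ab {hp hq} => [|k] [|l]//; rewrite ?addnS ?addSn.
pose g j := p * q^`M(j) - q * p^`M(j).
have hg j : g j \is (k + l).-1.-homog.
  apply: rpredB; first exact: mderiv_dhomog_mulr.
  by rewrite addnC; apply: mderiv_dhomog_mulr => //; rewrite addnC.
have := poly_int_divergence hg.
have -> : \sum_(j < d.+1) (g j)^`M(j) = 0.
  transitivity (p * laplacian q - q * laplacian p); last first.
    by rewrite lp lq !mulr0 subrr.
  rewrite /laplacian !mulr_sumr -sumrB; apply: eq_bigr => j _.
  by rewrite /g mderivB !mderivM; ring.
have -> : \sum_(j < d.+1) 'X_j * g j = (l%:R - k%:R) *: (p * q).
  transitivity (p * (l%:R *: q) - q * (k%:R *: p)).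
    rewrite -(euler_homogeneous hp) -(euler_homogeneous hq) !mulr_sumr -sumrB.
    by apply: eq_bigr => j _; rewrite /g; ring.
  by rewrite -!scalerAr scalerBl [q * p]mulrC.
rewrite raddf0 linearZ /= mulrA => /esym/eqP; rewrite mulf_eq0 => /orP[|/eqP//].
rewrite mulf_eq0 pnatr_eq0 addn_eq0 eqn0Ngt d0 /=.
by rewrite subr_eq0 eqr_nat eq_sym (negbTE ab).
Qed.

Lemma dhomog_msize_le l p : p \is l.-homog -> (msize p <= l.+1)%N.
Proof.
move=> /dhomogP hp; rewrite msizeE; apply/bigmax_leqP_seq => u up _.
by rewrite (hp _ up).
Qed.

(** Equality is required on the sphere only, where the factors [rsq] become [1]. The common bound
    [n] lets expansions be added degree by degree. *)
Definition harmonic_expansion n p (h : nat -> {mpoly R[d.+1]}) :=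
  [/\ forall l, h l \is l.-homog, forall l, laplacian (h l) = 0 &
      forall x : 'rV[R]_d.+1, sphere d x ->
        p.@[x ord0] = \sum_(l < n.+1) (h l).@[x ord0]].

Lemma harmonic_expansionD n p q hp hq :
  harmonic_expansion n p hp -> harmonic_expansion n q hq ->
  harmonic_expansion n (p + q) (fun l => hp l + hq l).
Proof.
move=> [p1 p2 p3] [q1 q2 q3]; split => [l|l|x sx]; first exact: rpredD.
  by rewrite linearD /= p2 q2 addr0.
rewrite mevalD p3// q3// -big_split; apply: eq_bigr => l _.
by rewrite mevalD.
Qed.

Lemma harmonic_expansion_harmonic n l p : (l <= n)%N -> p \is l.-homog ->
  laplacian p = 0 -> exists h, harmonic_expansion n p h.
Proof.
move=> ln hp lp; exists (fun l' => if l' == l then p else 0); split.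
- by move=> l'; case: eqP => [->//|_]; exact: dhomog0.
- by move=> l'; case: eqP => _ //; rewrite raddf0.
- move=> x sx; rewrite (bigD1 (Ordinal (ln : (l < n.+1)%N)))//= eqxx big1 ?addr0//.
  by move=> l' /eqP ll'; case: eqP => [e|_]; [case: ll'; exact: val_inj|exact: rmorph0].
Qed.

(** Strong induction on the degree: [p] is a harmonic part plus [rsq d * q], and the latter agrees
    on the sphere with [q], of degree two less. *)
Lemma harmonic_expansion_dhomog n l p : (l <= n)%N -> p \is l.-homog ->
  exists h, harmonic_expansion n p h.
Proof.
elim/ltn_ind: l p => l IH p ln hp; have [l1|l1] := leqP l 1.
  exact: (harmonic_expansion_harmonic ln hp (laplacian_dhomog_le1 l1 hp)).
case: l l1 IH ln hp => [//|[//|l]] _ IH ln hp.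
have [q hq lq] := harmonic_decomposition hp.
have hpq : p - rsq d * q \is l.+2.-homog.
  by apply: rpredB => //; rewrite -[l.+2]/(2 + l)%N dhomogM ?rsq_dhomog.
have [h1 H1] := harmonic_expansion_harmonic ln hpq lq.
have [h2 [a2 b2 c2]] := IH l (ltnW (ltnSn _)) q (ltnW (ltnW ln)) hq.
have H2 : harmonic_expansion n (rsq d * q) h2.
  by split => // x sx; rewrite mevalM meval_rsq// mul1r c2.
exists (fun l => h1 l + h2 l).
by have := harmonic_expansionD H1 H2; rewrite subrK.
Qed.

Lemma poly_harmonic_expansion n p : (msize p <= n.+1)%N ->
  exists h, harmonic_expansion n p h.
Proof.
move=> pn; rewrite (pihomog_partitionE pn).
elim/big_ind: _ => [|p1 p2 [h1 H1] [h2 H2]|l _].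
- exists (fun=> 0); split => [l|l|x _]; [exact: dhomog0|exact: raddf0|].
  by rewrite big1 => [|l _]; rewrite rmorph0.
- by exists (fun l => h1 l + h2 l); exact: harmonic_expansionD H1 H2.
- by apply: (@harmonic_expansion_dhomog _ l); [rewrite -ltnS|exact: pihomogP].
Qed.

End harmonic_orthogonality.

(** * Norms of functions on the sphere *)

(** The integral of a nonnegative function is the supremum over the simple functions below it, so
    monotonicity holds for arbitrary functions. *)
Lemma ge0_le_lower_integral d (T : measurableType d) (R : realType)
    (mu : {measure set T -> \bar R}) (D : set T) (f g : T -> \bar R) :
  (forall x, D x -> (0 <= f x)%E) -> (forall x, D x -> (f x <= g x)%E) ->
  (\int[mu]_(x in D) f x <= \int[mu]_(x in D) g x)%E.
Proof.
move=> f0 fg; rewrite !ge0_integralE//; last first.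
  by move=> x Dx; exact: le_trans (f0 x Dx) (fg x Dx).
apply: ereal_sup_le => _ [h hf <-]; exists h => //= x; apply: le_trans (hf x) _.
by rewrite !patchE; case: ifPn => //; rewrite inE => /fg.
Qed.

(** For positive [A] and [B] the choice [t = B / A] turns the bound into [(A + B) ^+ 2]. *)
Lemma sqrt_le_of_weighted (R : realType) (S A B : R) : 0 <= A -> 0 <= B ->
  (forall t, 0 < t -> S <= (1 + t) * A ^+ 2 + (1 + t^-1) * B ^+ 2) ->
  Num.sqrt S <= A + B.
Proof.
move=> A0 B0 hS; rewrite -(ger0_norm (addr_ge0 A0 B0)) -sqrtr_sqr ler_wsqrtr//.
apply/ler_addgt0Pr => e e0.
have AB : 0 < A + B + 1 by lra.
(* Shifting both numbers by [u] keeps the quotient [t] defined and positive when [A] or [B] is zero,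
   at the cost of an error [u * (A + B) <= e]. *)
pose u := e / (A + B + 1); have u0 : 0 < u by exact: divr_gt0.
have Au : 0 < A + u by lra.
have Bu : 0 < B + u by lra.
have ue : u * (A + B) <= e.
  have <- : u * (A + B + 1) = e by rewrite /u divfK// gt_eqF.
  by rewrite ler_pM2l// lerDl.
apply: le_trans (hS ((B + u) / (A + u)) (divr_gt0 Bu Au)) _.
have h1 : (B + u) / (A + u) * A ^+ 2 <= (B + u) * A.
  rewrite -mulrA ler_pM2l// mulrC ler_pdivrMr// expr2 ler_wpM2l// lerDl; exact: ltW.
have h2 : ((B + u) / (A + u))^-1 * B ^+ 2 <= (A + u) * B.
  rewrite invf_div -mulrA ler_pM2l// mulrC ler_pdivrMr// expr2 ler_wpM2l// lerDl; exact: ltW.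
by move: h1 h2 ue; rewrite !mulrDl !mul1r sqrrD mulrDr; lra.
Qed.

Section sphere_functions.
Context {R : realType} (d : nat).
Implicit Types (f : 'rV[R]_d.+1 -> R) (p q : {mpoly R[d.+1]}).

Lemma meval_continuous p : continuous (fun x : 'rV[R]_d.+1 => p.@[x ord0]).
Proof.
elim/(@mpoly_ring_ind R d): p => [c|i|p q cp cq|p q cp cq].
- by under eq_fun do rewrite mevalC; exact: cst_continuous.
- by under eq_fun do rewrite mevalXU; exact: coord_continuous.
- by under eq_fun do rewrite mevalD; move=> x; apply: continuousD; [exact: cp|exact: cq].
- by under eq_fun do rewrite mevalM; move=> x; apply: continuousM; [exact: cp|exact: cq].
Qed.

Lemma compact_sphere : compact (@sphere R d).
Proof.
apply: bounded_closed_compact.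
  exists 1; split; first exact: num_real.
  move=> M M1 x sx; rewrite /Num.norm /= mx_normrE; apply/bigmax_leP; split=> [|i _] /=.
    by apply: ltW; exact: lt_trans M1.
  by rewrite (ord1 i.1) (le_trans (enorm_coord x i.2))// sx ltW.
have -> : @sphere R d = (fun x : 'rV[R]_d.+1 => (rsq d).@[x ord0]) @^-1` [set 1].
  apply/seteqP; split => x /=; first exact: meval_rsq.
  rewrite /rsq raddf_sum /=; under eq_bigr do rewrite rmorphXn /= mevalXU.
  by move=> x1; rewrite /sphere /= /enorm x1 sqrtr1.
by apply: (continuous_closedP _).1; [exact: meval_continuous|exact: closed_eq].
Qed.

Lemma continuous_sphere_bounded f : {within sphere d, continuous f} ->
  exists C : R, forall x, sphere d x -> `|f x| <= C.
Proof.
move=> cf; have [M [_ hM]] := compact_bounded (continuous_compact cf compact_sphere).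
exists (M + 1) => x sx; apply: hM; first by rewrite ltrDl.
by exists x.
Qed.

(** The constant [C] certifies that the supremum is taken over a bounded set and is not a default
    value. *)
Lemma le_unif_norm f (C : R) : (forall x, sphere d x -> `|f x| <= C) ->
  forall x, sphere d x -> `|f x| <= unif_norm f.
Proof.
move=> fC x sx; apply: ub_le_sup; last by exists x.
by exists C => _ [y sy <-]; exact: fC.
Qed.

Lemma sphere_neq0 : exists x : 'rV[R]_d.+1, sphere d x.
Proof.
exists (delta_mx ord0 ord0); rewrite /sphere /= /enorm (bigD1 ord0)//= big1.
  by rewrite mxE !eqxx expr1n addr0 sqrtr1.
by move=> i /negbTE i0; rewrite mxE i0 andbF expr0n.
Qed.

Lemma sphere_int_le_poly f p :
  (forall x, sphere d x -> 0 <= f x <= p.@[x ord0]) -> sphere_int f <= poly_int p.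
Proof.
move=> fp; have mS := @measurable_sphere R d.
have ip := integrable_fin_num mS (meval_integrable p).
have le : (\int[sphere_measure d]_(x in sphere d) (f x)%:E <=
           \int[sphere_measure d]_(x in sphere d) (p.@[x ord0])%:E)%E.
  by apply: ge0_le_lower_integral => x /fp/andP[]; rewrite !lee_fin.
(* [fine] maps infinity to zero, so the integral of [f] must first be shown finite, by comparison
   with that of [p]. *)
apply: fine_le => //; rewrite ge0_fin_numE; last first.
  by apply: integral_ge0 => x /fp/andP[]; rewrite lee_fin.
by apply: le_lt_trans le _; rewrite ltey_eq ip.
Qed.

Lemma poly_int_sqr_ge0 p : 0 <= poly_int (p ^+ 2).
Proof. by apply: sphere_int_ge0 => x _; rewrite rmorphXn sqr_ge0. Qed.

(* Minkowski's inequality, through [2 a b <= t a^2 + t^-1 b^2] so that [f] need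
   not be measurable. *)
Lemma L2norm_le_poly f p q :
  (forall x, sphere d x -> `|f x| <= `|p.@[x ord0]| + `|q.@[x ord0]|) ->
  L2norm f <= Num.sqrt (poly_int (p ^+ 2)) + Num.sqrt (poly_int (q ^+ 2)).
Proof.
move=> fpq; apply: sqrt_le_of_weighted; [exact: sqrtr_ge0|exact: sqrtr_ge0|].
move=> t t0; rewrite !sqr_sqrtr ?poly_int_sqr_ge0//.
have -> : (1 + t) * poly_int (p ^+ 2) + (1 + t^-1) * poly_int (q ^+ 2) =
    poly_int ((1 + t) *: p ^+ 2 + (1 + t^-1) *: q ^+ 2).
  by rewrite linearD !linearZ.
apply: sphere_int_le_poly => x sx; rewrite sqr_ge0 /= mevalD !mevalZ !rmorphXn /=.
have := fpq x sx; rewrite -(real_normK (num_real (f x))).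
rewrite -(real_normK (num_real p.@[_])) -(real_normK (num_real q.@[_])).
move: (normr_ge0 (f x)) (normr_ge0 p.@[x ord0]) (normr_ge0 q.@[x ord0]).
move: `|f x| `|p.@[x ord0]| `|q.@[x ord0]| => F a b F0 a0 b0 Fab.
have : F ^+ 2 <= (a + b) ^+ 2 by rewrite ler_pXn2r// nnegrE ?addr_ge0.
move=> /le_trans; apply.
have tn : t != 0 by rewrite gt_eqF.
have : 0 <= t^-1 * (t * a - b) ^+ 2 by rewrite mulr_ge0 ?sqr_ge0// invr_ge0 ltW.
have -> : t^-1 * (t * a - b) ^+ 2 = t * a ^+ 2 + t^-1 * b ^+ 2 - 2 * a * b by field.
by move=> h; rewrite sqrrD !mulrDl !mul1r; lra.
Qed.

Lemma L2norm_meval p : L2norm (fun x => p.@[x ord0]) = Num.sqrt (poly_int (p ^+ 2)).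
Proof. by congr Num.sqrt; apply: eq_sphere_int => x _; rewrite rmorphXn. Qed.

End sphere_functions.

(** * Hyperinterpolation *)

Section discrete_projection.
Context {R : realType} (d n m : nat).
Variables (x : 'I_m -> 'rV[R]_d.+1) (w : 'I_m -> R) (eta : R).
Hypothesis sx : forall j, sphere d (x j).
Hypothesis w0 : forall j, 0 <= w j.
Hypothesis eta0 : 0 <= eta.
Hypothesis MZ : MZ_property x w n eta.
(** An abstract orthonormal polynomial family; [I] will be the set of pairs of a degree and an index
    within that degree. *)
Variables (I : finType) (e : I -> {mpoly R[d.+1]}).
Hypothesis e_orthonormal : forall i j, poly_int (e i * e j) = (i == j)%:R.
Hypothesis e_size : forall i, (msize (e i) <= n.+1)%N.
Hypothesis e_span : forall p, (msize p <= n.+1)%N -> exists c : I -> R,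
  forall y : 'rV[R]_d.+1, sphere d y -> p.@[y ord0] = \sum_i c i * (e i).@[y ord0].
Implicit Types (v : 'I_m -> R) (p : {mpoly R[d.+1]}).

Let dot v p := \sum_(j < m) w j * v j * p.@[x j ord0].

(** Hyperinterpolation as a function of the values at the nodes, so that it applies alike to [f], to
    a polynomial and to their difference. *)
Definition discrete_projection v := \sum_i dot v (e i) *: e i.

Lemma msize_discrete_projection v : (msize (discrete_projection v) <= n.+1)%N.
Proof.
rewrite /discrete_projection; elim/big_ind: _ => [|p q hp hq|i _].
- by rewrite mmeasure0.
- by apply: (leq_trans (msizeD_le p q)); rewrite geq_max hp.
- exact: leq_trans (msizeZ_le _ _) (e_size i).
Qed.

(** The projection represents the functional [dot v]: expand [p] in the family [e], on the sphere
    and hence at the nodes, and use orthonormality. *)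
Lemma poly_int_discrete_projection v p : (msize p <= n.+1)%N ->
  poly_int (discrete_projection v * p) = dot v p.
Proof.
move=> /e_span[c hc]; pose q := \sum_i c i *: e i.
have pq y : sphere d y -> p.@[y ord0] = q.@[y ord0].
  by move=> sy; rewrite hc// raddf_sum; apply: eq_bigr => i _; rewrite /= mevalZ.
rewrite (_ : poly_int _ = poly_int (discrete_projection v * q)); last first.
  by apply: poly_int_eq => y sy; rewrite !mevalM pq.
rewrite /dot; under eq_bigr do rewrite pq//.
transitivity (\sum_i dot v (e i) * c i).
  rewrite /discrete_projection mulr_suml raddf_sum; apply: eq_bigr => i _ /=.
  rewrite -scalerAl linearZ /=; congr (_ * _).
  rewrite /q mulr_sumr raddf_sum (bigD1 i)//= big1 => [|k ki].
    by rewrite -scalerAr linearZ /= e_orthonormal eqxx addr0; exact: mulr1.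
  by rewrite -scalerAr linearZ /= e_orthonormal eq_sym (negbTE ki); exact: mulr0.
transitivity (\sum_i \sum_(j < m) w j * v j * (e i).@[x j ord0] * c i).
  by apply: eq_bigr => i _; rewrite mulr_suml.
rewrite exchange_big; apply: eq_bigr => j _ /=.
rewrite raddf_sum mulr_sumr; apply: eq_bigr => i _ /=.
by rewrite mevalZ; ring.
Qed.

Lemma MZ_poly p : (msize p <= n.+1)%N ->
  (1 - eta) * poly_int (p ^+ 2) <= \sum_(j < m) w j * p.@[x j ord0] ^+ 2
    <= (1 + eta) * poly_int (p ^+ 2).
Proof.
move=> pn; have := MZ (chi := fun y => p.@[y ord0]) _.
have -> : sphere_int (fun y : 'rV[R]_d.+1 => p.@[y ord0] ^+ 2) = poly_int (p ^+ 2).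
  by apply: eq_sphere_int => y _; rewrite rmorphXn.
move=> /(_ (ex_intro2 _ _ p pn (fun _ _ => erefl))).
by rewrite ler_distl mulrBl mulrDl !mul1r.
Qed.

(* The square [\sum_j w_j ((1 + eta) v_j - u(x_j))^2], with [u] the projection of
   [v], is nonnegative. *)
Lemma discrete_projection_bound v :
  poly_int (discrete_projection v ^+ 2) <= (1 + eta) * \sum_(j < m) w j * v j ^+ 2.
Proof.
set u := discrete_projection v.
have un : (msize u <= n.+1)%N by exact: msize_discrete_projection.
have uu : poly_int (u ^+ 2) = dot v u by rewrite expr2 poly_int_discrete_projection.
have /andP[_ hu] := MZ_poly un.
have : 0 <= \sum_(j < m) w j * ((1 + eta) * v j - u.@[x j ord0]) ^+ 2.
  by apply: sumr_ge0 => j _; rewrite mulr_ge0// sqr_ge0.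
have -> : \sum_(j < m) w j * ((1 + eta) * v j - u.@[x j ord0]) ^+ 2 =
    (1 + eta) ^+ 2 * (\sum_(j < m) w j * v j ^+ 2) - 2 * (1 + eta) * dot v u +
    \sum_(j < m) w j * u.@[x j ord0] ^+ 2.
  rewrite /dot !mulr_sumr -sumrB -big_split; apply: eq_bigr => j _ /=; ring.
have k0 : 0 < 1 + eta by rewrite ltr_wpDr.
(* With [a] the integral of [u ^+ 2], the last sum is at most [(1 + eta) * a], so that
   [(1 + eta) * a] is bounded by [(1 + eta) ^+ 2] times the weighted sum of the [v j ^+ 2]. *)
rewrite -uu => h; rewrite -(ler_pM2l k0).
by move: h hu; move: (poly_int _) (\sum_j _) (\sum_j _) => a b c; nra.
Qed.

(** After expansion of the square, the cross term is a discrete norm of [p], bounded below by the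
    Marcinkiewicz-Zygmund property; its upper half, after [discrete_projection_bound], controls the
    first square. *)
Lemma discrete_projection_error p : (msize p <= n.+1)%N ->
  poly_int ((discrete_projection (fun j => p.@[x j ord0]) - p) ^+ 2) <=
  (eta ^+ 2 + 4 * eta) * poly_int (p ^+ 2).
Proof.
move=> pn; set v := fun j => p.@[x j ord0]; set u := discrete_projection v.
have := discrete_projection_bound v; rewrite -/u.
have /andP[h1 h2] := MZ_poly pn.
have up : poly_int (u * p) = \sum_(j < m) w j * v j ^+ 2.
  rewrite poly_int_discrete_projection//; apply: eq_bigr => j _.
  by rewrite /v expr2 mulrA.
have -> : (u - p) ^+ 2 = u ^+ 2 - 2 *: (u * p) + p ^+ 2.
  by rewrite scaler_nat sqrrB.
rewrite linearD linearB linearZ /= up => h3.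
have h4 : poly_int (u ^+ 2) <= (1 + eta) ^+ 2 * poly_int (p ^+ 2).
  by apply: (le_trans h3); rewrite expr2 -mulrA ler_wpM2l ?addr_ge0.
rewrite (_ : 2 *: _ = 2 * \sum_(j < m) w j * v j ^+ 2)//.
move: h1 h4; rewrite -/(v _) => h1 h4.
have -> : (eta ^+ 2 + 4 * eta) * poly_int (p ^+ 2) =
  (1 + eta) ^+ 2 * poly_int (p ^+ 2) - 2 * ((1 - eta) * poly_int (p ^+ 2)) +
    poly_int (p ^+ 2) by ring.
by rewrite lerD2r lerB// ler_pM2l.
Qed.

Lemma discrete_projectionB v1 v2 : discrete_projection (fun j => v1 j - v2 j) =
  discrete_projection v1 - discrete_projection v2.
Proof.
rewrite /discrete_projection -sumrB; apply: eq_bigr => i _; rewrite -scalerBl.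
by congr (_ *: _); rewrite /dot -sumrB; apply: eq_bigr => j _; ring.
Qed.

End discrete_projection.

(** * Spherical harmonics as an orthonormal basis of the polynomials on the sphere *)

Section orthonormal_harmonics.
Context {R : realType} (d n : nat) (d0 : (0 < d)%N).
Variables (Z : nat -> nat) (Y : forall l, 'I_(Z l) -> 'rV[R]_d.+1 -> R).
Arguments Y : clear implicits.
Hypothesis hY : forall l, orthonormal_basis (harmonics l) (Y l).

Let harmonic_index := {l : 'I_n.+1 & 'I_(Z l)}.

(** Orthonormality within one degree is that of the given bases, across degrees it is Green's
    identity; spanning comes from the harmonic expansion. *)
Lemma harmonic_polynomials : exists e : harmonic_index -> {mpoly R[d.+1]},
  [/\ forall i, restricts (e i) (Y (tag i) (tagged i)),
      forall i, (msize (e i) <= n.+1)%N,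
      forall i j, poly_int (e i * e j) = (i == j)%:R &
      forall p, (msize p <= n.+1)%N -> exists c : harmonic_index -> R,
        forall y : 'rV[R]_d.+1, sphere d y ->
          p.@[y ord0] = \sum_i c i * (e i).@[y ord0]].
Proof.
have hp l k : harmonics l (Y l k) by have [] := hY l.
pose y l k := projT1 (cid (hp l k)).
have yE l k : [/\ y l k \is l.-homog, laplacian (y l k) = 0 & restricts (y l k) (Y l k)].
  exact: (projT2 (cid (hp l k))).
exists (fun i : harmonic_index => y (tag i) (tagged i)); split.
- by move=> i; have [] := yE (tag i) (tagged i).
- move=> i; have [h _ _] := yE (tag i) (tagged i).
  exact: leq_trans (dhomog_msize_le h) (ltn_ord (tag i)).
- move=> [l k] [l' k'] /=; have [ll'|ll'] := eqVneq l l'.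
    subst l'; rewrite -tag_eqE /tag_eq /= eqxx tagged_asE /=.
    have [_ <- _] := hY l; apply: eq_sphere_int => x sx.
    have [_ _ h] := yE l k; have [_ _ h'] := yE l k'.
    by rewrite mevalM h// h'.
  rewrite -tag_eqE /tag_eq /= (negbTE ll') /=.
  have [h1 h2 _] := yE l k; have [h1' h2' _] := yE l' k'.
  exact: (poly_int_harmonic_orthogonal d0 _ h1 h1' h2 h2').
move=> p /poly_harmonic_expansion[h [hh lh ph]].
have hc l : exists c : 'I_(Z l) -> R, forall x, sphere d x ->
    (h l).@[x ord0] = \sum_(k < Z l) c k * Y l k x.
  by have [_ _] := hY l; apply; exists (h l); split.
pose c l := projT1 (cid (hc l)).
exists (fun i : harmonic_index => c (tag i) (tagged i)) => x sx; rewrite ph//.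
rewrite (eq_bigr (fun l : 'I_n.+1 => \sum_(k < Z l) c l k * (y l k).@[x ord0])).
  by rewrite (sig_big_dep _ _ (fun (l : 'I_n.+1) (k : 'I_(Z l)) => c l k * (y l k).@[x ord0])).
move=> l _; rewrite (projT2 (cid (hc l)) x sx); apply: eq_bigr => k _.
by have [_ _ ->] := yE l k.
Qed.

End orthonormal_harmonics.

(** * Stability and error bounds for the hyperinterpolant *)

Theorem theorem3p1 (R : realType) (d n m : nat) (hd : (2 <= d)%N)
    (Z : nat -> nat) (Y : forall l, 'I_(Z l) -> 'rV[R]_d.+1 -> R)
    (hY : forall l, orthonormal_basis (harmonics l) (Y l))
    (x : 'I_m -> 'rV[R]_d.+1) (hx : forall j, sphere d (x j))
    (w : 'I_m -> R) (hw : forall j, 0 < w j)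
    (eta : R) (heta : 0 <= eta < 1) (hMZ : MZ_property x w n eta)
    (f : 'rV[R]_d.+1 -> R) (hf : {within sphere d, continuous f}) :
  let Uf := hyperinterpolant x w Y n f in
  L2norm Uf <=
    Num.sqrt (1 + eta) * Num.sqrt (\sum_(j < m) w j) * unif_norm f
  /\
  forall chi_star : 'rV[R]_d.+1 -> R,
    poly_space n chi_star ->
    unif_norm (f \- chi_star) = best_error n f ->
    L2norm (Uf \- f) <=
      (Num.sqrt (1 + eta) * Num.sqrt (\sum_(j < m) w j)
         + Num.sqrt (sphere_int (fun _ : 'rV[R]_d.+1 => 1))) * best_error n f
      + Num.sqrt (eta ^+ 2 + 4 * eta) * L2norm chi_star.
Proof.
have d0 : (0 < d)%N by exact: ltnW.
have [e [eY esize eorth espan]] := harmonic_polynomials n d0 hY.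
have /andP[eta0 _] := heta; have w0 j := ltW (hw j).
pose proj v := discrete_projection x w e v.
(* The weighted sum of the [v j ^+ 2] is at most [E ^+ 2] times the total weight. *)
have bound v (E : R) : 0 <= E -> (forall j, `|v j| <= E) ->
    Num.sqrt (poly_int (proj v ^+ 2)) <=
    Num.sqrt (1 + eta) * Num.sqrt (\sum_(j < m) w j) * E.
  move=> E0 vE; have k0 : 0 <= 1 + eta by exact: addr_ge0.
  have W0 : 0 <= \sum_(j < m) w j by apply: sumr_ge0.
  rewrite -[X in _ * X](ger0_norm E0) -sqrtr_sqr -!sqrtrM ?mulr_ge0//.
  rewrite ler_wsqrtr// (le_trans (discrete_projection_bound hx w0 eta0 hMZ eorth esize espan _))//.
  rewrite -mulrA ler_wpM2l// mulr_suml ler_sum// => j _; rewrite ler_wpM2l//.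
  by rewrite -(real_normK (num_real (v j))) ler_pXn2r// nnegrE.
have UE y : sphere d y -> hyperinterpolant x w Y n f y =
    (proj (fun j => f (x j))).@[y ord0].
  move=> sy; rewrite /hyperinterpolant /proj /discrete_projection raddf_sum /=.
  rewrite (sig_big_dep _ _ (fun (l : 'I_n.+1) (k : 'I_(Z l)) =>
    discrete_dot x w f (Y l k) * Y l k y)) /=.
  apply: eq_bigr => i _; rewrite mevalZ eY//; congr (_ * _).
  by apply: eq_bigr => j _; rewrite eY.
have [C fC] := continuous_sphere_bounded hf.
have unif_ge0 g (D : R) : (forall y, sphere d y -> `|g y| <= D) -> 0 <= unif_norm g.
  have [y sy] := @sphere_neq0 R d.
  by move=> gD; exact: le_trans (normr_ge0 _) (le_unif_norm gD sy).
split.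
  rewrite (_ : L2norm _ = Num.sqrt (poly_int (proj (fun j => f (x j)) ^+ 2))).
    by apply: bound => [|j]; [exact: unif_ge0 fC|exact: le_unif_norm fC _ (hx j)].
  rewrite -L2norm_meval; congr Num.sqrt; apply: eq_sphere_int => y sy.
  by rewrite /= UE.
move=> chi [p pn pchi] hE; have [P _ hP] := meval_sphere_bounded p.
have gC y : sphere d y -> `|(f \- chi) y| <= C + P.
  by move=> sy; rewrite /= (le_trans (ler_normB _ _))// lerD ?fC// pchi// hP.
rewrite -hE; set E := unif_norm _; have E0 : 0 <= E by exact: unif_ge0 gC.
have gE y : sphere d y -> `|f y - chi y| <= E by move=> sy; exact: le_unif_norm gC y sy.
(* [u] is the hyperinterpolant of [f - chi], and [v] is the error of hyperinterpolating [chi]. *)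
pose u := proj (fun j => f (x j) - p.@[x j ord0]).
pose v := proj (fun j => p.@[x j ord0]) - p.
have chiE : L2norm chi = Num.sqrt (poly_int (p ^+ 2)).
  by rewrite -L2norm_meval; congr Num.sqrt; apply: eq_sphere_int => y sy; rewrite pchi.
(* The constant [E] dominates [f - chi]; as a polynomial it fits the triangle inequality
   [L2norm_le_poly] and contributes the factor with the area of the sphere. *)
pose cE : {mpoly R[d.+1]} := E%:MP.
have normE : Num.sqrt (poly_int (cE ^+ 2)) =
    Num.sqrt (sphere_int (fun _ : 'rV[R]_d.+1 => 1)) * E.
  rewrite (_ : poly_int _ = poly_int (E ^+ 2 *: 1 : {mpoly R[d.+1]})); last first.
    by apply: poly_int_eq => y _; rewrite rmorphXn /= /cE mevalC mevalZ meval1 mulr1.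
  rewrite linearZ /= sqrtrM ?sqr_ge0// sqrtr_sqr ger0_norm// mulrC.
  congr (Num.sqrt _ * _).
  by apply: eq_sphere_int => y _; rewrite meval1.
have uB : Num.sqrt (poly_int (u ^+ 2)) <=
    Num.sqrt (1 + eta) * Num.sqrt (\sum_(j < m) w j) * E.
  by apply: bound => // j; rewrite -pchi//; exact: gE.
have vB : Num.sqrt (poly_int (v ^+ 2)) <= Num.sqrt (eta ^+ 2 + 4 * eta) * L2norm chi.
  rewrite chiE -sqrtrM ?addr_ge0 ?sqr_ge0 ?mulr_ge0// ler_wsqrtr//.
  exact: (discrete_projection_error hx w0 eta0 hMZ eorth esize espan).
have uvB : Num.sqrt (poly_int ((u + v) ^+ 2)) <=
    Num.sqrt (poly_int (u ^+ 2)) + Num.sqrt (poly_int (v ^+ 2)).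
  by rewrite -L2norm_meval; apply: L2norm_le_poly => y _; rewrite mevalD ler_normD.
have : L2norm (hyperinterpolant x w Y n f \- f) <=
    Num.sqrt (poly_int ((u + v) ^+ 2)) + Num.sqrt (poly_int (cE ^+ 2)).
  apply: L2norm_le_poly => y sy; rewrite /= /cE mevalC (ger0_norm E0).
  rewrite (_ : _ - f y = (u + v).@[y ord0] - (f y - chi y)).
    by rewrite (le_trans (ler_normB _ _))// lerD2l gE.
  rewrite UE// /u /v /proj discrete_projectionB pchi// mevalD !mevalB; ring.
move=> /le_trans; apply; rewrite normE mulrDl addrAC lerD2r.
exact: le_trans uvB (lerD uB vB).
Qed.
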